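(* Procedure EXTEND, applied to the given optimal $l$-length closest substring $v_{opt}$ of $\mathcal{S}$, is an approximation algorithm for Reopt-CSP$_{\mathcal{M}_{l+1}}$ that outputs an $(l+1)$-length string $v'_{sol}$ with $\mathrm{cost}(v'_{sol})\le \mathrm{cost}(v'_{opt})+t$, where $v'_{opt}$ is an optimal $(l+1)$-length closest substring of $\mathcal{S}$, and it runs in $O(2^t)$ time.
   Context: For strings $u,w$ of equal length, $d(u,w)$ is the Hamming distance. Let $\mathcal{S}=\{S_1,\dots,S_t\}$ be sequences over a finite alphabet $\Sigma$, each of length $n$. For $v\in\Sigma^m$, $\mathrm{cost}(v)=\sum_{i=1}^t\min\{d(v,y): y\text{ an } m\text{-length substring of } S_i\}$; an optimal $m$-length closest substring minimizes this over $\Sigma^m$. For a set of equal-length strings $y'_1,\dots,y'_t$, their consensus is the string obtained by taking, at each position, a majority symbol among them; the cost of this set is $\sum_i d(v,y'_i)$ with $v$ the consensus. Reopt-CSP$_{\mathcal{M}_{l+1}}$: given $\mathcal{S}$ and an optimal $l$-length closest substring $v_{opt}$, find an $(l+1)$-length closest substring. Procedure EXTEND on input an $l$-length string $v$: for each $i$ take an $l$-length substring $y_i$ of $S_i$ minimizing $d(v,y_i)$; for each $x\in\{0,1\}^t$, let $y'_i$ be the $(l+1)$-length substring of $S_i$ obtained by extending $y_i$ by one symbol to the left if $x[i]=1$ and to the right otherwise; output the consensus $v'_{sol}$ of the set $\{y'_1,\dots,y'_t\}$ of minimum cost over all $x$.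
   Formalization: Since a prefix or suffix y_i of S_i cannot be extended both ways, only x whose extensions all exist are used, and all y_i are assumed extensible to the right or all to the left (otherwise the bound can fail); O(2^t) is proved with a factor polynomial in n and |Σ|; t>0 and l<n. *)

(* Defs.v *)
From mathcomp Require Import all_boot.

Set Implicit Arguments.
Unset Strict Implicit.
Unset Printing Implicit Defensive.

Section Problem.

Variable Sigma : finType.

(* Only used on strings of equal length. *)
Definition hamming (u w : seq Sigma) : nat :=
  count (fun ab => ab.1 != ab.2) (zip u w).

(* The m-length factor of s starting at position p (0-based), meant for
   p + m <= size s. *)
Definition window (m p : nat) (s : seq Sigma) : seq Sigma := take m (drop p s).

Definition substrings (m : nat) (s : seq Sigma) : seq (seq Sigma) :=
  [seq window m p s | p <- iota 0 ((size s).+1 - m)].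

Section Instance.

Variables (t n : nat) (S : t.-tuple (n.-tuple Sigma)).

(* The neutral element m bounds every distance from above, so that the big
   operator is the true minimum as soon as m <= n. *)
Definition cost (m : nat) (v : m.-tuple Sigma) : nat :=
  \sum_(i < t) \big[minn/m]_(y <- substrings m (tnth S i)) hamming v y.

Definition optimal_closest_substring (m : nat) (v : m.-tuple Sigma) : Prop :=
  forall w : m.-tuple Sigma, cost v <= cost w.

(* A majority symbol is a most frequent one; ties are broken arbitrarily. *)
Definition is_consensus (m : nat) (Y : 'I_t -> seq Sigma)
    (v : m.-tuple Sigma) : Prop :=
  forall (j : 'I_m) (a : Sigma),
    #|[set i | onth (Y i) j == Some a]|
      <= #|[set i | onth (Y i) j == Some (tnth v j)]|.

(* The cost of the set Y, when v is its consensus. *)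
Definition set_cost (m : nat) (Y : 'I_t -> seq Sigma) (v : m.-tuple Sigma)
    : nat :=
  \sum_(i < t) hamming v (Y i).

(* Procedure EXTEND, as a relation allowing every choice of the y_i and every
   way of breaking ties. The chosen substring y_i is given by its starting
   position p i in S_i. *)

Section Extend.

Variables (l : nat) (v : l.-tuple Sigma).

Definition closest_occurrences (p : 'I_t -> nat) : Prop :=
  forall i, p i + l <= n /\
    forall q, q + l <= n ->
      hamming v (window l (p i) (tnth S i)) <= hamming v (window l q (tnth S i)).

(* y_i has no extension to the left (right) when it is a prefix (suffix) of
   S_i: only the x all of whose extensions exist are taken into account. *)
Definition extensible (p : 'I_t -> nat) (x : t.-tuple bool) : Prop :=
  forall i, if tnth x i then 0 < p i else p i + l < n.

Definition extension (p : 'I_t -> nat) (x : t.-tuple bool) (i : 'I_t)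
    : seq Sigma :=
  window l.+1 (if tnth x i then (p i).-1 else p i) (tnth S i).

Definition EXTEND (p : 'I_t -> nat) (vsol : l.+1.-tuple Sigma) : Prop :=
  closest_occurrences p /\
  exists x : t.-tuple bool,
    [/\ extensible p x,
        is_consensus (extension p x) vsol &
        forall (x' : t.-tuple bool) (w : l.+1.-tuple Sigma),
          extensible p x' -> is_consensus (extension p x') w ->
          set_cost (extension p x) vsol <= set_cost (extension p x') w].

(* All the y_i can be extended to the right, or all of them to the left. *)
Definition extensible_on_one_side (p : 'I_t -> nat) : Prop :=
  extensible p [tuple of nseq t false] \/ extensible p [tuple of nseq t true].

End Extend.

End Instance.

End Problem.

(* An implementation of EXTEND with its running time. A computation returns a
   value together with the number of steps. Every call of a function below
   costs one step, besides the steps of the calls it makes, and does a bounded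
   number of operations on list cells, pairs, symbols and machine integers. *)

Definition timed (A : Type) : Type := (A * nat)%type.

Definition ret (A : Type) (a : A) : timed A := (a, 0).

Definition bind (A B : Type) (m : timed A) (f : A -> timed B) : timed B :=
  let: (a, i) := m in let: (b, j) := f a in (b, i + j).

Definition step (A : Type) (m : timed A) : timed A :=
  let: (a, i) := m in (a, i.+1).

Notation "'let*' x := m 'in' f" := (bind m (fun x => f))
  (at level 200, x name, m at level 100, f at level 200).

Section Program.

Variable Sigma : eqType.

Fixpoint hamming_prog (u w : seq Sigma) : timed nat := step
  match u, w with
  | a :: u', b :: w' =>
      let* d := hamming_prog u' w' in ret (if a == b then d else d.+1)
  | _, _ => ret 0
  end.

(* None when s is too short. *)
Fixpoint prefix_prog (m : nat) (s : seq Sigma) : timed (option (seq Sigma)) :=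
  step
  match m, s with
  | 0, _ => ret (Some [::])
  | m'.+1, a :: s' => let* r := prefix_prog m' s' in ret (omap (cons a) r)
  | _.+1, [::] => ret None
  end.

(* The left and the right extension of a substring, when they exist. *)
Definition extensions : Type := (option (seq Sigma) * option (seq Sigma))%type.

(* Finds the leftmost (rightmost, if last) closest l-length substring; prev is
   the symbol before s, and best the best candidate so far with its distance. *)
Fixpoint scan (last : bool) (l : nat) (v : seq Sigma) (prev : option Sigma)
    (s : seq Sigma) (best : option (nat * extensions))
    : timed (option (nat * extensions)) := step
  (let* y := prefix_prog l s in
   let* best' :=
     match y with
     | None => ret best
     | Some y =>
         let* d := hamming_prog v y in
         let* r := prefix_prog l.+1 s in
         let new := Some (d, (omap (fun a => a :: y) prev, r)) in
         ret match best with
             | None => new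
             | Some (d0, _) =>
                 if (if last then d <= d0 else d < d0) then new else best
             end
     end in
   match s with
   | [::] => ret best'
   | a :: s' => scan last l v (Some a) s' best'
   end).

Fixpoint scan_all (last : bool) (l : nat) (v : seq Sigma) (S : seq (seq Sigma))
    : timed (seq extensions) := step
  match S with
  | [::] => ret [::]
  | s :: S' =>
      let* b := scan last l v None s None in
      let* es := scan_all last l v S' in
      ret ((if b is Some (_, e) then e else (None, None)) :: es)
  end.

Fixpoint all_right (es : seq extensions) : timed bool := step
  match es with
  | [::] => ret true
  | (_, Some _) :: es' => all_right es'
  | (_, None) :: _ => ret false
  end.

(* For one position of the strings: the number of occurrences of each symbol. *)
Definition column : Type := seq (Sigma * nat).

Fixpoint blank_column (alphabet : seq Sigma) : timed column := step
  match alphabet with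
  | [::] => ret [::]
  | a :: alphabet' => let* c := blank_column alphabet' in ret ((a, 0) :: c)
  end.

Fixpoint blank_table (m : nat) (c : column) : timed (seq column) := step
  match m with
  | 0 => ret [::]
  | m'.+1 => let* T := blank_table m' c in ret (c :: T)
  end.

Fixpoint add_symbol (a : Sigma) (c : column) : timed column := step
  match c with
  | [::] => ret [::]
  | (b, k) :: c' =>
      let* c'' := add_symbol a c' in
      ret ((b, if a == b then k.+1 else k) :: c'')
  end.

Fixpoint add_string (y : seq Sigma) (T : seq column) : timed (seq column) :=
  step
  match y, T with
  | a :: y', c :: T' =>
      let* c' := add_symbol a c in
      let* T'' := add_string y' T' in
      ret (c' :: T'')
  | _, _ => ret [::]
  end.

(* A most frequent symbol, its count, and the sum of all the counts. *)
Fixpoint majority (c : column) : timed (option (Sigma * nat) * nat) := step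
  match c with
  | [::] => ret (None, 0)
  | (a, k) :: c' =>
      let* r := majority c' in
      ret (match r.1 with
           | Some (b, k') => if k' <= k then Some (a, k) else Some (b, k')
           | None => Some (a, k)
           end, k + r.2)
  end.

(* The cost and the consensus of the strings counted in T; None can only occur
   on an empty alphabet. *)
Fixpoint consensus_prog (T : seq column) : timed (option (nat * seq Sigma)) :=
  step
  match T with
  | [::] => ret (Some (0, [::]))
  | c :: T' =>
      let* r := majority c in
      let* r' := consensus_prog T' in
      ret match r.1, r' with
          | Some (a, k), Some (d, w) => Some ((r.2 - k) + d, a :: w)
          | _, _ => None
          end
  end.

Definition cheapest (r1 r2 : option (nat * seq Sigma))
    : option (nat * seq Sigma) :=
  match r1, r2 with
  | Some (d1, _), Some (d2, _) => if d1 <= d2 then r1 else r2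
  | Some _, None => r1
  | None, _ => r2
  end.

(* Explores the binary tree of the x in {0,1}^t; T counts the symbols of the
   extensions selected so far. *)
Fixpoint search (es : seq extensions) (T : seq column)
    : timed (option (nat * seq Sigma)) := step
  match es with
  | [::] => consensus_prog T
  | (yl, yr) :: es' =>
      let* r1 :=
        match yr with
        | Some y => let* T' := add_string y T in search es' T'
        | None => ret None
        end in
      let* r2 :=
        match yl with
        | Some y => let* T' := add_string y T in search es' T'
        | None => ret None
        end in
      ret (cheapest r1 r2)
  end.

Definition extend_prog (alphabet : seq Sigma) (S : seq (seq Sigma)) (l : nat)
    (v : seq Sigma) : timed (option (seq Sigma)) := step
  (let* es := scan_all false l v S in
   let* right := all_right es in
   let* es' := if right then ret es else scan_all true l v S in
   let* c := blank_column alphabet in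
   let* T := blank_table l.+1 c in
   let* r := search es' T in
   ret (omap snd r)).

End Program.

(* Main.v *)
Require Import Defs.
From mathcomp Require Import all_boot zify.

(* Approximation: padding vopt by one arbitrary symbol on the side where all
   the y_i are extensible costs at most t more than vopt, the consensus costs no
   more than any other string on the same extensions, and vopt costs no more
   than the l-prefix of vopt'.
   Program: scanning returns the leftmost closest occurrences, or else the
   rightmost ones, which are extensible on one side whenever some choice is. The
   search carries the table of symbol counts per position, from which the cost
   of the consensus is read off as the sum of total minus maximal counts, so a
   node of the binary tree takes time O(n |Sigma|), and the t scans are absorbed
   by t <= 2^t. *)

Set Implicit Arguments.
Unset Strict Implicit.
Unset Printing Implicit Defensive.

(** * Minima over lists, Hamming distance and windows *)

Lemma bigminn_le (I : eqType) (s : seq I) (F : I -> nat) (m : nat) (y : I) :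
  y \in s -> \big[minn/m]_(z <- s) F z <= F y.
Proof.
elim: s => // z s IHs; rewrite inE big_cons geq_min => /predU1P[<-|/IHs->].
  by rewrite leqnn.
by rewrite orbT.
Qed.

(** The default [m] never undercuts a value of [F], so on a nonempty list the big operator is a true
    minimum. *)
Lemma bigminn_attained (I : eqType) (s : seq I) (F : I -> nat) (m : nat) :
  s != [::] -> {in s, forall y, F y <= m} ->
  exists2 y, y \in s & \big[minn/m]_(z <- s) F z = F y.
Proof.
elim: s => // z s IHs _ Fm; rewrite big_cons.
have Fzm : F z <= m by apply: Fm; rewrite mem_head.
case: (eqVneq s [::]) => [->|s0].
  by exists z; rewrite ?mem_head // big_nil; apply/minn_idPl.
have [|y ys ->] := IHs s0; first by move=> y ys; rewrite Fm // inE ys orbT.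
case: (leqP (F z) (F y)) => _; first by exists z; rewrite ?mem_head.
by exists y; rewrite // inE ys orbT.
Qed.

Section Strings.

Variable Sigma : finType.
Implicit Types (u v w y s : seq Sigma) (m p q l : nat).

(** Expressing mismatches through [onth] matches the counts in [is_consensus], and prepares the
    exchange of sums over strings and positions. *)
Lemma hamming_sum u w : size u = size w ->
  hamming u w = \sum_(j < size u) (onth w j != onth u j).
Proof.
elim: u w => [|a u IHu] [|b w] //=; first by rewrite big_ord0.
move=> [/IHu uw]; rewrite big_ord_recl /=.
rewrite [LHS](_ : _ = (a != b) + hamming u w) // uw.
by rewrite [Some b == _]eq_sym.
Qed.

Lemma hamming_tuple m (v : m.-tuple Sigma) y : size y = m ->
  hamming v y = \sum_(j < m) (onth y j != Some (tnth v j)).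
Proof.
move=> ym; rewrite hamming_sum ?size_tuple //; apply: eq_bigr => j _.
by have /tnth_onth -> : tnth v j = tnth v j by [].
Qed.

Lemma hamming_le u w : hamming u w <= size u.
Proof. by rewrite (leq_trans (count_size _ _)) // size_zip geq_minl. Qed.

Lemma hamming_rcons u w a b : size u = size w ->
  hamming (rcons u a) (rcons w b) = hamming u w + (a != b).
Proof. by move=> uw; rewrite /hamming zip_rcons // -cats1 count_cat /= addn0. Qed.

Lemma hamming_take k u w : hamming (take k u) (take k w) <= hamming u w.
Proof.
elim: k u w => [|k IHk] [|a u] [|b w] //=.
exact: (leq_add (leqnn (a != b)) (IHk u w)).
Qed.

Lemma size_window m p s : p + m <= size s -> size (window m p s) = m.
Proof. by move=> pm; rewrite size_take size_drop; case: ltnP => //; lia. Qed.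

Lemma windowSr a l p s : p + l < size s ->
  window l.+1 p s = rcons (window l p s) (nth a s (p + l)).
Proof.
by move=> pl; rewrite /window (take_nth a) ?nth_drop // size_drop; lia.
Qed.

Lemma windowSl a l p s : p < size s ->
  window l.+1 p s = nth a s p :: window l p.+1 s.
Proof. by move=> ps; rewrite /window (drop_nth a ps). Qed.

Lemma substringsP m s y : m <= size s ->
  reflect (exists2 p, p + m <= size s & y = window m p s)
          (y \in substrings m s).
Proof.
move=> ms; apply: (iffP mapP) => -[p pm ->]; exists p => //.
  by move: pm; rewrite mem_iota; lia.
by rewrite mem_iota; lia.
Qed.

End Strings.

(** * Approximation guarantee of [EXTEND] *)

Section Approximation.

Variables (Sigma : finType) (t n : nat) (S : t.-tuple (n.-tuple Sigma)).

Lemma cost_le_set_cost m (v : m.-tuple Sigma) (Y : 'I_t -> seq Sigma) :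
  (forall i, Y i \in substrings m (tnth S i)) -> cost S v <= set_cost Y v.
Proof. by move=> YS; apply: leq_sum => i _; apply: bigminn_le. Qed.

(** A window closest to [w] can lose its last symbol along with [w]: it remains a window at the same
    position, and truncation never increases the Hamming distance. *)
Lemma cost_take l (w : l.+1.-tuple Sigma) (u : l.-tuple Sigma) :
  l < n -> tval u = take l w -> cost S u <= cost S w.
Proof.
move=> ln uE; apply: leq_sum => i _; set s := tnth S i.
have ls : l < size s by rewrite size_tuple.
have [||y /(substringsP _ ls)[p pl ->] ->] :=
  @bigminn_attained _ (substrings l.+1 s) (hamming w) l.+1.
- by rewrite -size_eq0 size_map size_iota; lia.
- by move=> y _; rewrite (leq_trans (hamming_le _ _)) ?size_tuple.
apply: (@leq_trans (hamming u (window l p s))).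
  by apply: bigminn_le; apply/substringsP; [lia | exists p => //; lia].
have -> : window l p s = take l (window l.+1 p s).
  by rewrite /window take_takel.
by rewrite uE hamming_take.
Qed.

Lemma closest_occurrences_cost l (v : l.-tuple Sigma) (p : 'I_t -> nat) :
  l <= n -> closest_occurrences S v p ->
  \sum_(i < t) hamming v (window l (p i) (tnth S i)) <= cost S v.
Proof.
move=> ln cp; apply: leq_sum => i _; set s := tnth S i.
have ls : l <= size s by rewrite size_tuple.
have [||y /(substringsP _ ls)[q ql ->] ->] :=
  @bigminn_attained _ (substrings l s) (hamming v) l.
- by rewrite -size_eq0 size_map size_iota; lia.
- by move=> y _; rewrite (leq_trans (hamming_le _ _)) ?size_tuple.
by have [_ ->] := cp i; rewrite // -(size_tuple s).
Qed.

(** Double counting of mismatches: at each position, the strings that disagree with [v] are the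
    complement of those that agree. *)
Lemma set_cost_sum m (Y : 'I_t -> seq Sigma) (v : m.-tuple Sigma) :
  (forall i, size (Y i) = m) ->
  set_cost Y v = \sum_(j < m) (t - #|[set i | onth (Y i) j == Some (tnth v j)]|).
Proof.
move=> Ym; rewrite /set_cost.
under eq_bigr => i _ do rewrite hamming_tuple //.
rewrite exchange_big /=; apply: eq_bigr => j _.
set A := [set i | _]; have := cardsC A; rewrite card_ord => tA.
rewrite -[X in X - _]tA addKn -sum1_card.
by rewrite [RHS]big_mkcond; apply: eq_bigr => i _; rewrite !inE; case: (_ == _).
Qed.

(** By [set_cost_sum] the positions are independent, and a majority symbol maximises the count
    subtracted at each of them. *)
Lemma consensus_set_cost_le m (Y : 'I_t -> seq Sigma) (v w : m.-tuple Sigma) :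
  (forall i, size (Y i) = m) -> is_consensus Y v -> set_cost Y v <= set_cost Y w.
Proof.
move=> Ym cv; rewrite !set_cost_sum //; apply: leq_sum => j _.
exact/leq_sub2l/cv.
Qed.

Lemma consensus_exists m (Y : 'I_t -> seq Sigma) (a0 : Sigma) :
  exists v : m.-tuple Sigma, is_consensus Y v.
Proof.
pose f (j : 'I_m) := [arg max_(a > a0) #|[set i | onth (Y i) j == Some a]|].
exists (mktuple f) => j a; rewrite tnth_mktuple /f.
by case: arg_maxnP => // b _; apply.
Qed.

Section Extension.

Variables (l : nat) (p : 'I_t -> nat).

Lemma extension_substring x i : p i + l <= n -> extensible n l p x ->
  extension S l p x i \in substrings l.+1 (tnth S i).
Proof.
move=> pl /(_ i); have sn : size (tnth S i) = n by rewrite size_tuple.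
rewrite /extension => xi; apply/substringsP; first by case: (tnth x i) xi; lia.
by rewrite sn; eexists; last by []; case: (tnth x i) xi; lia.
Qed.

Lemma size_extension x i : p i + l <= n -> extensible n l p x ->
  size (extension S l p x i) = l.+1.
Proof.
move=> pl /(_ i) xi; rewrite size_window ?size_tuple //.
by case: (tnth x i) xi; lia.
Qed.

(** When all strings are extended on the same side, the old positions stay aligned with [v]; only
    the new position can add a mismatch, at most one per string. *)
Lemma set_cost_one_side (v : l.-tuple Sigma) (a0 : Sigma) :
  (forall i, p i + l <= n) -> extensible_on_one_side n l p ->
  exists x (w : l.+1.-tuple Sigma), extensible n l p x /\
    set_cost (extension S l p x) w
      <= \sum_(i < t) hamming v (window l (p i) (tnth S i)) + t.
Proof.
move=> pl; have sumS (F : 'I_t -> nat) : \sum_(i < t) (F i).+1 = \sum_i F i + t.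
  rewrite -[X in _ + X]card_ord -sum1_card -big_split /=.
  by apply: eq_bigr => i _; rewrite addn1.
case=> xp; [exists [tuple of nseq t false], [tuple of rcons v a0]
          | exists [tuple of nseq t true], [tuple of a0 :: v]];
  split=> //; rewrite -sumS; apply: leq_sum => i _;
  have sn : size (tnth S i) = n by rewrite size_tuple.
all: have := xp i; rewrite /extension (tnth_nth true) nth_nseq ltn_ord.
  move=> pln; rewrite (windowSr a0) ?sn // hamming_rcons; last first.
    by rewrite size_window ?size_tuple.
  by rewrite -addn1 leq_add2l leq_b1.
move=> p0; rewrite (windowSl a0); last by rewrite sn; have := pl i; lia.
rewrite prednK // [hamming _ _](_ : _ =
  (a0 != nth a0 (tnth S i) (p i).-1)
    + hamming v (window l (p i) (tnth S i))) //.
by rewrite -add1n leq_add2r leq_b1.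
Qed.

End Extension.

Lemma EXTEND_approximation l (vopt : l.-tuple Sigma) p
    (vsol vopt' : l.+1.-tuple Sigma) :
  0 < t -> l < n -> optimal_closest_substring S vopt ->
  EXTEND S vopt p vsol -> extensible_on_one_side n l p ->
  cost S vsol <= cost S vopt' + t.
Proof.
move=> t0 ln opt [cp [x [xp cx min_x]]] one.
have pl i : p i + l <= n by have [] := cp i.
have s0 : size (tnth S (Ordinal t0)) = n by rewrite size_tuple.
have [a0] : exists a : Sigma, a \in tval (tnth S (Ordinal t0)).
  case: (tval _) s0 => [|a s _]; first by move=> /=; lia.
  by exists a; rewrite mem_head.
move=> _; have [x' [w [xp' w_le]]] := set_cost_one_side vopt a0 pl one.
(* [w] need not be a consensus, whereas minimality in [EXTEND] compares consensuses only; [w']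
   bridges the two. *)
have [w' cw'] := consensus_exists l.+1 (extension S l p x') a0.
apply: leq_trans (cost_le_set_cost _ _) _.
  by move=> i; apply: extension_substring (xp).
apply: leq_trans (min_x _ _ xp' cw') _.
apply: leq_trans (consensus_set_cost_le w _ cw') _.
  by move=> i; apply: size_extension (xp').
apply: leq_trans w_le _; rewrite leq_add2r.
apply: leq_trans (closest_occurrences_cost (ltnW ln) cp) _.
have szt : size (take l vopt') == l by rewrite size_takel // size_tuple.
exact: leq_trans (opt (Tuple szt)) (cost_take (u := Tuple szt) ln erefl).
Qed.

End Approximation.

(** * Running time of the program *)

Lemma bind_val A B (m : timed A) (f : A -> timed B) : (bind m f).1 = (f m.1).1.
Proof. by case: m => a i /=; case: (f a). Qed.

Lemma bind_time A B (m : timed A) (f : A -> timed B) :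
  (bind m f).2 = m.2 + (f m.1).2.
Proof. by case: m => a i /=; case: (f a). Qed.

Lemma step_val A (m : timed A) : (step m).1 = m.1.
Proof. by case: m. Qed.

Lemma step_time A (m : timed A) : (step m).2 = m.2.+1.
Proof. by case: m. Qed.

Definition timedE := (bind_val, bind_time, step_val, step_time).

Section RunningTime.

Variable Sigma : eqType.

Lemma hamming_prog_time (u w : seq Sigma) : (hamming_prog u w).2 <= (size u).+1.
Proof.
by elim: u w => [|a u IHu] [|b w] //=; rewrite !timedE /= addn0 ltnS.
Qed.

Lemma prefix_prog_time m (s : seq Sigma) : (prefix_prog m s).2 <= m.+1.
Proof. by elim: m s => [|m IHm] [|a s] //=; rewrite !timedE /= addn0 ltnS. Qed.

(** The inner [match] of [scan], named so that [scanE] unfolds one call uniformly for empty and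
    nonempty [s]. *)
Definition scan_update (last : bool) l (v : seq Sigma) prev s
    (best : option (nat * extensions Sigma)) (y : option (seq Sigma)) :=
  match y with
  | None => ret best
  | Some y =>
      let* d := hamming_prog v y in
      let* r := prefix_prog l.+1 s in
      let new := Some (d, (omap (fun a => a :: y) prev, r)) in
      ret match best with
          | None => new
          | Some (d0, _) =>
              if (if last then d <= d0 else d < d0) then new else best
          end
  end.

Lemma scanE last l (v : seq Sigma) prev s best :
  scan last l v prev s best = step
    (let* y := prefix_prog l s in
     let* best' := scan_update last l v prev s best y in
     match s with
     | [::] => ret best'
     | a :: s' => scan last l v (Some a) s' best'
     end).
Proof. by case: s. Qed.

Lemma scan_update_time last l (v : seq Sigma) prev s best y : size v = l ->
  (scan_update last l v prev s best y).2 <= 2 * l + 3.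
Proof.
move=> vl; case: y => [z|] //; rewrite /scan_update !bind_time [(ret _).2]/=.
by have := hamming_prog_time v z; have := prefix_prog_time l.+1 s; lia.
Qed.

(** A call costs one step, at most [l + 1] for the prefix and at most [2 * l + 3] for the update;
    there is one call per suffix of [s], the empty one included. *)
Lemma scan_time last l (v : seq Sigma) prev s best : size v = l ->
  (scan last l v prev s best).2 <= (size s).+1 * (3 * l + 5).
Proof.
move=> vl; elim: s prev best => [|a s IHs] prev best; rewrite scanE !timedE.
all: set y := prefix_prog l _; have ly : y.2 <= l.+1 by apply: prefix_prog_time.
all: set b := scan_update _ _ _ _ _ _ _.
all: have lb : b.2 <= 2 * l + 3 by apply: scan_update_time.
  by rewrite /=; nia.
by have := IHs (Some a) b.1; rewrite [size (a :: s)]/=; nia.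
Qed.

Lemma scan_all_time last l n (v : seq Sigma) S :
  size v = l -> (forall s, s \in S -> size s = n) ->
  (scan_all last l v S).2 <= (size S * (n.+1 * (3 * l + 5)).+1).+1.
Proof.
move=> vl; elim: S => [|s S IHS] //= Sn; rewrite !timedE /= addn0.
have := scan_time last None s None vl; rewrite (Sn s) ?mem_head //.
have /IHS : forall s, s \in S -> size s = n.
  by move=> s' sS; rewrite Sn // inE sS orbT.
by move=> leS les; rewrite mulSn ltnS addSn -addnS leq_add.
Qed.

Lemma all_right_time (es : seq (extensions Sigma)) :
  (all_right es).2 <= (size es).+1.
Proof. by elim: es => [|[yl [yr|]] es IHes] //=; rewrite step_time. Qed.

Lemma blank_column_time (al : seq Sigma) : (blank_column al).2 = (size al).+1.
Proof. by elim: al => //= a al IHal; rewrite !timedE IHal addn0. Qed.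

Lemma blank_table_time m (c : column Sigma) : (blank_table m c).2 = m.+1.
Proof. by elim: m => //= m IHm; rewrite !timedE IHm addn0. Qed.

Lemma add_symbol_time (a : Sigma) c : (add_symbol a c).2 = (size c).+1.
Proof. by elim: c => [|[b k] c IHc] //=; rewrite !timedE IHc addn0. Qed.

Lemma size_add_symbol (a : Sigma) c : size (add_symbol a c).1 = size c.
Proof. by elim: c => [|[b k] c IHc] //=; rewrite !timedE /= IHc. Qed.

(** Each column visited costs [k.+1] steps in [add_symbol] and one more for the call of [add_string]
    itself. *)
Lemma add_string_time (y : seq Sigma) T k : all (fun c => size c == k) T ->
  (add_string y T).2 <= (size T * k.+2).+1.
Proof.
elim: T y => [|c T IHT] [|a y] //= /andP[/eqP ck /(IHT y) leT].
by rewrite !timedE /= add_symbol_time ck addn0 ltnS mulSn [k.+2 + _]addSn -addnS leq_add2l.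
Qed.

Lemma size_add_string_le (y : seq Sigma) T : size (add_string y T).1 <= size T.
Proof.
by elim: T y => [|c T IHT] [|a y] //=; rewrite !timedE /= ltnS.
Qed.

Lemma all_size_add_string (y : seq Sigma) T k : all (fun c => size c == k) T ->
  all (fun c => size c == k) (add_string y T).1.
Proof.
elim: T y => [|c T IHT] [|a y] //= /andP[ck /(IHT y)].
by rewrite !timedE /= size_add_symbol ck.
Qed.

Lemma majority_time (c : column Sigma) : (majority c).2 = (size c).+1.
Proof. by elim: c => [|[b k] c IHc] //=; rewrite !timedE IHc addn0. Qed.

Lemma consensus_prog_time (T : seq (column Sigma)) k :
  all (fun c => size c == k) T ->
  (consensus_prog T).2 <= (size T * k.+2).+1.
Proof.
elim: T => [|c T IHT] //= /andP[/eqP ck /IHT leT].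
by rewrite !timedE /= majority_time ck addn0 ltnS mulSn [k.+2 + _]addSn -addnS leq_add2l.
Qed.

(* A node of the search tree costs at most 2 * D + 1 besides its two subtrees,
   and a leaf at most D + 1; adding 2 * D + 1 on the left makes the bound
   inductive. *)
Lemma search_time (es : seq (extensions Sigma)) T k D :
  all (fun c => size c == k) T -> size T * k.+2 < D ->
  (search es T).2 + (2 * D).+1 <= 2 ^ size es * (3 * D + 2).
Proof.
elim: es T => [|[yl yr] es IHes] T Tk TD.
  rewrite /= step_time expn0 mul1n; have := leq_trans (consensus_prog_time Tk) TD.
  by move: (consensus_prog T).2; lia.
(* [add_string] uses at most [D] of the slack [2 * D + 1] and leaves [D.+1]; the remainders of the
   two branches pay for the step of the node and for its own slack. *)
have branch y : (bind (add_string y T) (search es)).2 + D.+1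
    <= 2 ^ size es * (3 * D + 2).
  rewrite bind_time; set T' := (add_string y T).1.
  have /(IHes T' (all_size_add_string y Tk)) : size T' * k.+2 < D.
    by apply: leq_ltn_trans TD; rewrite leq_mul2r size_add_string_le orbT.
  have := leq_trans (add_string_time y Tk) TD.
  by move: (add_string y T).2 (search es T').2; lia.
(* A missing extension takes no time, but must satisfy the same bound as a branch. *)
have pos : D.+1 <= 2 ^ size es * (3 * D + 2).
  by have := expn_gt0 2 (size es); nia.
rewrite /= !timedE /= expnS addn0.
set b1 := match yr with Some _ => _ | None => _ end.
set b2 := match yl with Some _ => _ | None => _ end.
have : b1.2 + D.+1 <= 2 ^ size es * (3 * D + 2) by rewrite /b1; case: (yr).
have : b2.2 + D.+1 <= 2 ^ size es * (3 * D + 2) by rewrite /b2; case: (yl).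
by move: b1.2 b2.2; lia.
Qed.

Lemma size_scan_all last l (v : seq Sigma) S :
  size (scan_all last l v S).1 = size S.
Proof. by elim: S => //= s S IHS; rewrite !timedE /= IHS. Qed.

Lemma blank_columnE (al : seq Sigma) :
  (blank_column al).1 = [seq (a, 0) | a <- al].
Proof. by elim: al => //= a al IHal; rewrite !timedE IHal. Qed.

Lemma blank_tableE m (c : column Sigma) : (blank_table m c).1 = nseq m c.
Proof. by elim: m => //= m IHm; rewrite !timedE IHm. Qed.

(** The exponent 2 has two sources: a scan compares windows of length [l] at [n.+1] positions, and a
    node of the tree handles [l.+1] columns of [size al] entries. *)
Lemma extend_prog_time (al : seq Sigma) S l n (v : seq Sigma) :
  size v = l -> l < n -> (forall s, s \in S -> size s = n) ->
  (extend_prog al S l v).2 <= 100 * (n + size al) ^ 2 * 2 ^ size S.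
Proof.
(* Hiding the successor keeps [blank_table] folded while rewriting with [timedE]. *)
move=> vl ln Sn; rewrite /extend_prog; move lm: l.+1 => m.
rewrite !timedE [(ret _).2]/= addn0.
set es := scan_all false l v S; set es' := (if _ then _ else _).
have es1 : es.2 <= (size S * (n.+1 * (3 * l + 5)).+1).+1.
  exact: scan_all_time.
have es2 : es'.2 <= (size S * (n.+1 * (3 * l + 5)).+1).+1.
  by rewrite /es'; case: ifP => // _; exact: scan_all_time.
have szes' : size es'.1 = size S by rewrite /es'; case: ifP; rewrite size_scan_all.
have := all_right_time es.1; rewrite size_scan_all.
rewrite blank_column_time blank_table_time blank_tableE blank_columnE.
set T := nseq _ _ => es3.
have Tk : all (fun c => size c == size al) T by rewrite all_nseq size_map eqxx orbT.
have /(search_time es'.1 Tk) : size T * (size al).+2 < (l.+1 * (size al).+2).+1.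
  by rewrite size_nseq lm.
rewrite szes' -{m}lm in T Tk * => es4.
move: es.2 (all_right es.1).2 es'.2 (search es'.1 T).2 es1 es2 es3 es4.
move: (size al) (size S) => k t c1 c2 c3 c4 le1 le3 le2 le4.
(* Pure arithmetic from here on: every term is compared with [P]. The tree contributes at most
   [14 * P] and each scan about [17 * P], well below [100 * P]. *)
clear -ln le1 le2 le3 le4.
set P := (n + k) ^ 2 * 2 ^ t; set N := n + k in P *.
have [lN kN nN] : [/\ l < N, k <= N & n <= N] by split; lia.
have NN : N <= N ^ 2 by rewrite -mulnn leq_pmulr //; lia.
have NP : N ^ 2 <= P by rewrite leq_pmulr // expn_gt0.
have tP : 2 ^ t <= P by rewrite leq_pmull //; lia.
have treeP : 2 ^ t * (3 * (l.+1 * k.+2).+1 + 2) <= 14 * P.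
  rewrite mulnC /P mulnA leq_mul2r; apply/orP; right.
  have : l.+1 * k.+2 <= N * (3 * N) by rewrite leq_mul //; lia.
  by rewrite mulnCA mulnn; lia.
have t2 : t < 2 ^ t by rewrite ltn_expl.
have scanP : t * (n.+1 * (3 * l + 5)).+1 <= 17 * P.
  rewrite mulnC /P mulnA leq_mul ?(ltnW t2) //.
  have : n.+1 * (3 * l + 5) <= (2 * N) * (8 * N) by rewrite leq_mul //; lia.
  by rewrite mulnACA mulnn; lia.
rewrite -mulnA -/P; clearbody P; clearbody N.
move: (2 ^ t) (N ^ 2) (t * _) (2 ^ t * _) le1 le2 le3 le4
  treeP scanP NN NP tP t2 => *.
lia.
Qed.

End RunningTime.

(** * Correctness of the scan for closest occurrences *)

Section Scan.

Variables (Sigma : finType) (last : bool) (l : nat) (v s0 : seq Sigma).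

Lemma hamming_progE (u w : seq Sigma) : (hamming_prog u w).1 = hamming u w.
Proof.
elim: u w => [|a u IHu] [|b w] //=; rewrite !timedE /= IHu.
by rewrite /hamming /=; case: eqP.
Qed.

Lemma prefix_progE m (s : seq Sigma) :
  (prefix_prog m s).1 = if m <= size s then Some (take m s) else None.
Proof.
by elim: m s => [|m IHm] [|a s] //=; rewrite !timedE /= IHm ltnS; case: leqP.
Qed.

Definition extensions_at (s : seq Sigma) q : extensions Sigma :=
  (if 0 < q then Some (window l.+1 q.-1 s) else None,
   if q + l < size s then Some (window l.+1 q s) else None).

(** The tie-break singles out one position: the rightmost closest one if [last], the leftmost
    otherwise. *)
Definition preferred q q' : Prop :=
  hamming v (window l q s0) <= hamming v (window l q' s0) /\
  (hamming v (window l q s0) = hamming v (window l q' s0) ->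
   if last then q' <= q else q <= q').

Definition best_before k q : Prop :=
  [/\ q < k, q + l <= size s0 &
      forall q', q' < k -> q' + l <= size s0 -> preferred q q'].

(** A candidate is absent only before the first position: with [l <= size s0], position 0 already
    provides one. *)
Definition scan_invariant k (best : option (nat * extensions Sigma)) : Prop :=
  if best is Some b then
    exists2 q, best_before k q
             & b = (hamming v (window l q s0), extensions_at s0 q)
  else k = 0.

Definition symbol_before k : option Sigma :=
  if k is k'.+1 then onth s0 k' else None.

Lemma scan_update_invariant k best : l <= size s0 -> k <= size s0 ->
  scan_invariant k best ->
  scan_invariant k.+1
    (scan_update last l v (symbol_before k) (drop k s0) best
       (prefix_prog l (drop k s0)).1).1.
Proof.
move=> ls ks; rewrite /scan_update prefix_progE size_drop.
(* If no window of length [l] starts at [k], the best candidate so far stays best. *)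
case: leqP => lk; last first.
  case: best => [b|] /=; last by lia.
  case=> q [qk ql min_q] bE; exists q => //; split=> // [|q' q'k q'l]; first lia.
  by apply: min_q => //; lia.
rewrite !bind_val hamming_progE prefix_progE size_drop.
have -> : (if l < size s0 - k then Some (take l.+1 (drop k s0)) else None)
        = (extensions_at s0 k).2.
  rewrite /extensions_at /=.
  by have -> : (l < size s0 - k) = (k + l < size s0) by lia.
(* The window of length [l.+1] starting one position earlier is the preceding symbol followed by the
   window at [k]. *)
have -> : omap (fun a => a :: take l (drop k s0)) (symbol_before k)
        = (extensions_at s0 k).1.
  rewrite /extensions_at; case: k ks {lk} => [|k] ks //=.
  have := onthTE s0 k; rewrite ks; case ska: (onth s0 k) => [a|] // _.
  by rewrite /= (windowSl a) // (onth_nth a a s0 k ska).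
rewrite -surjective_pairing -/(window l k s0).
set d := hamming v (window l k s0).
case: best => [[d0 e0]|] /=.
  case=> q [qk ql min_q] [-> ->].
  case: ifP => dd.
    exists k => //; split=> // [|q' q'k q'l]; first lia.
    have [->|kq'] := eqVneq q' k; first by split=> // _; case: (last).
    have [] := min_q q' _ q'l; first by lia.
    by move: dd; rewrite /preferred -/d; case: (last); lia.
  exists q => //; split=> // [|q' q'k q'l]; first lia.
  have [->|kq'] := eqVneq q' k; last by apply: min_q => //; lia.
  by move: dd; rewrite /preferred -/d; case: (last); lia.
move=> k0; exists k => //; split=> // [|q' q'k _]; first by lia.
have -> : q' = k by lia.
by split=> // _; case: (last).
Qed.

(** Induction along the suffixes of [s0]. The empty suffix is examined too, hence the bound
    [(size s0).+1]; it is a genuine candidate when [l] is 0. *)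
Lemma scan_from k s best : l <= size s0 -> k <= size s0 -> s = drop k s0 ->
  scan_invariant k best ->
  exists2 q, best_before (size s0).+1 q &
    (scan last l v (symbol_before k) s best).1
      = Some (hamming v (window l q s0), extensions_at s0 q).
Proof.
move=> ls; elim: s k best => [|a s IHs] k best ks sE inv;
  have := scan_update_invariant ls ks inv; rewrite scanE !timedE -sE;
  move: (scan_update _ _ _ _ _ _ _).1 => best' inv'.
  have {}ks : k = size s0 by have := congr1 size sE; rewrite size_drop /=; lia.
  case: best' inv' => [b|] //= [q qk ->]; exists q => //.
  by rewrite -ks.
have ks' : k < size s0 by have := congr1 size sE; rewrite size_drop /=; lia.
have [ka sE'] : onth s0 k = Some a /\ s = drop k.+1 s0.
  by move: sE; rewrite (drop_nth a ks') -odflt_onth => -[]; have := onthTE s0 k;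
     rewrite ks'; case: onth => //= b _ -> ->.
by have := IHs k.+1 best' ks' sE' inv'; rewrite [symbol_before _]ka.
Qed.

Lemma scan_correct : l <= size s0 ->
  exists2 q, best_before (size s0).+1 q &
    (scan last l v None s0 None).1
      = Some (hamming v (window l q s0), extensions_at s0 q).
Proof. by move=> ls; apply: (@scan_from 0) => //; rewrite drop0. Qed.

End Scan.

(** * Symbol counts and the search over extensions *)

Section Search.

Variable Sigma : finType.
Implicit Types (f : nat -> Sigma -> nat) (al : seq Sigma) (y : seq Sigma)
  (r : option (nat * seq Sigma)).

(** Presenting a table by a function of position and symbol turns the effect of [add_string] into a
    change of [f]. *)
Definition frequencies al f m : seq (column Sigma) :=
  mkseq (fun j => [seq (a, f j a) | a <- al]) m.

Lemma add_symbolE (a : Sigma) c :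
  (add_symbol a c).1 = [seq (bk.1, (a == bk.1) + bk.2) | bk <- c].
Proof.
by elim: c => [|[b k] c IHc] //=; rewrite !timedE /= IHc; case: (a == b).
Qed.

Lemma mkseqSl (T : Type) (F : nat -> T) m :
  mkseq F m.+1 = F 0 :: mkseq (fun j => F j.+1) m.
Proof. by rewrite /mkseq /= (iotaDl 1 0 m) -map_comp. Qed.

Lemma add_string_frequencies al f y :
  (add_string y (frequencies al f (size y))).1
    = frequencies al (fun j a => (onth y j == Some a) + f j a) (size y).
Proof.
elim: y f => [|a y IHy] f //; rewrite /frequencies [size _]/= !mkseqSl /= !timedE /=.
rewrite [X in _ :: X](IHy (fun j => f j.+1)) add_symbolE -map_comp.
by congr (_ :: _).
Qed.

Lemma majority_frequencies al (g : Sigma -> nat)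
    (r := majority [seq (a, g a) | a <- al]) :
  al != [::] ->
  r.1.2 = \sum_(a <- al) g a /\
  exists2 a, r.1.1 = Some (a, g a) & {in al, forall b, g b <= g a}.
Proof.
rewrite {}/r; elim: al => // a al IHal _ /=; rewrite !timedE /= big_cons.
case: (eqVneq al [::]) => [->|/IHal[-> [b -> maxb]]].
  by rewrite /= big_nil; split=> //; exists a => // b; rewrite inE => /eqP->.
split=> //=; case: leqP => ba.
  exists a => // c; rewrite inE => /predU1P[->|/maxb] //.
  by move=> cb; apply: leq_trans ba.
by exists b => // c; rewrite inE => /predU1P[->|/maxb] //; apply: ltnW.
Qed.

Lemma consensus_frequencies al f m : al != [::] ->
  exists2 g : nat -> Sigma,
    forall j, j < m -> {in al, forall b, f j b <= f j (g j)} &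
    (consensus_prog (frequencies al f m)).1
      = Some (\sum_(j < m) (\sum_(a <- al) f j a - f j (g j)), mkseq g m).
Proof.
move=> al0; elim: m f => [|m IHm] f.
  by case: al al0 => // a al _; exists (fun=> a); rewrite //= big_ord0.
have [g gmax gE] := IHm (fun j => f j.+1).
have [sumE [a aE amax]] := majority_frequencies (f 0) al0.
exists (fun j => if j is j'.+1 then g j' else a) => [[|j] //|]; first exact: gmax.
rewrite /frequencies !mkseqSl /= !timedE /= aE sumE.
by rewrite [X in match X with Some _ => _ | None => _ end]gE big_ord_recl.
Qed.

(** The state of [search] once the strings [ys] have been counted. *)
Definition string_table (ys : seq (seq Sigma)) m :=
  frequencies (enum Sigma) (fun j a => count (fun y => onth y j == Some a) ys) m.

Lemma add_string_table y ys m : size y = m ->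
  (add_string y (string_table ys m)).1 = string_table (y :: ys) m.
(* What remains holds by conversion, since [count] on a cons unfolds to the sum produced by
   [add_string]. *)
Proof. by move=> <-; rewrite add_string_frequencies. Qed.

Lemma blank_string_table m :
  (blank_table m (blank_column (enum Sigma)).1).1 = string_table [::] m.
Proof.
rewrite blank_tableE blank_columnE.
apply: (@eq_from_nth _ [::]) => [|j]; rewrite size_nseq ?size_mkseq // => jm.
by rewrite nth_nseq jm nth_mkseq.
Qed.

(** Every string has exactly one symbol at each position, so the counts of a column sum to
    [size ys], and total minus maximum is the number of mismatches with the majority symbol. Summing
    by strings instead of positions gives Hamming distances. *)
Lemma consensus_string_table ys m (a0 : Sigma) :
  {in ys, forall y, size y = m} ->
  exists2 w : m.-tuple Sigma,
    (consensus_prog (string_table ys m)).1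
      = Some (\sum_(y <- ys) hamming w y, tval w) &
    forall (j : 'I_m) a, count (fun y => onth y j == Some a) ys
                           <= count (fun y => onth y j == Some (tnth w j)) ys.
Proof.
move=> ysm; have al0 : enum Sigma != [::].
  by apply/eqP => /(congr1 (mem^~ a0)); rewrite inE mem_enum.
set f := fun j a => count (fun y => onth y j == Some a) ys.
have [g gmax gE] := consensus_frequencies f m al0.
exists (mktuple (fun j : 'I_m => g j)) => [|j a]; last first.
  by rewrite tnth_mktuple; apply: gmax; rewrite ?mem_enum.
rewrite /string_table gE; congr (Some (_, _)); last first.
  by rewrite /= /mkseq -val_enum_ord -map_comp.
transitivity (\sum_(j < m) \sum_(y <- ys) (onth y j != Some (g j))).
  apply: eq_bigr => j _.
  have -> : \sum_(a <- enum Sigma) f j a = size ys.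
    rewrite /f; elim: ys ysm {f gmax gE} => [|y ys IHys] ysm /=.
      by rewrite big1.
    rewrite big_split /= IHys => [|z zys]; last by rewrite ysm // inE zys orbT.
    have := onthTE y j; rewrite ysm ?mem_head // ltn_ord.
    case: onth => // b _; rewrite big_enum /= (bigD1 b) //= eqxx big1 // => a ab.
    by rewrite (inj_eq Some_inj) eq_sym (negPf ab).
  rewrite -(count_predC (fun y => onth y j == Some (g j)) ys) /f addKn.
  by rewrite -sum1_count big_mkcond; apply: eq_bigr => y _ /=; case: (_ == _).
rewrite exchange_big; apply: eq_big_seq => y /ysm ym.
by rewrite hamming_tuple //; apply: eq_bigr => j _; rewrite tnth_mktuple.
Qed.

Definition selected (e : extensions Sigma) (b : bool) : option (seq Sigma) :=
  if b then e.1 else e.2.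

(** [map Some] forces every selected extension to exist: a selection is a path of the tree that
    reaches a leaf. *)
Definition selection es (x : seq bool) (zs : seq (seq Sigma)) : Prop :=
  size x = size es /\ [seq selected eb.1 eb.2 | eb <- zip es x] = map Some zs.

Lemma selection_nil x zs : selection [::] x zs -> x = [::] /\ zs = [::].
Proof. by case: x zs => [|b x] [|z zs] []. Qed.

Lemma selection_cons e es x zs : selection (e :: es) x zs <->
  exists b x' z zs', [/\ x = b :: x', zs = z :: zs',
                         selected e b = Some z & selection es x' zs'].
Proof.
split=> [[]|[b [x' [z [zs' [-> -> eb [sx sE]]]]]]]; last first.
  by split; rewrite /= ?sx // eb sE.
case: x => // b x [sx]; case: zs => // z zs [eb sE].
by exists b, x, z, zs.
Qed.

(** Existence of both results is included, so that minimality of the search also yields its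
    success. *)
Definition cheaper (r r' : option (nat * seq Sigma)) : Prop :=
  exists c c', [/\ r = Some c, r' = Some c' & c.1 <= c'.1].

Lemma cheapest_l r1 r2 r : cheaper r1 r -> cheaper (cheapest r1 r2) r.
Proof.
case=> [[d1 w1] [[d w] [-> -> le1]]]; case: r2 => [[d2 w2]|] /=; last first.
  by exists (d1, w1), (d, w).
case: leqP => le12; first by exists (d1, w1), (d, w).
exists (d2, w2), (d, w); split=> //=; exact: leq_trans (ltnW le12) le1.
Qed.

Lemma cheapest_r r1 r2 r : cheaper r2 r -> cheaper (cheapest r1 r2) r.
Proof.
case=> [[d2 w2] [[d w] [-> -> le2]]]; case: r1 => [[d1 w1]|] /=; last first.
  by exists (d2, w2), (d, w).
case: leqP => le12; last by exists (d2, w2), (d, w).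
exists (d1, w1), (d, w); split=> //=; exact: leq_trans le12 le2.
Qed.

Lemma cheapest_mem r1 r2 : cheapest r1 r2 = r1 \/ cheapest r1 r2 = r2.
Proof.
case: r1 r2 => [[d1 w1]|] [[d2 w2]|] /=; try by [left | right].
by case: leqP; [left | right].
Qed.

(** Generalised over the strings [ys] already counted, most recent first, whence [catrev].
    Minimality and attainment both pass through [cheapest], which returns one of its arguments and
    costs no more than either. *)
Lemma search_correct m (a0 : Sigma) es ys
    (r := (search es (string_table ys m)).1) :
  (forall e b y, List.In e es -> selected e b = Some y -> size y = m) ->
  {in ys, forall y, size y = m} ->
  (forall x zs, selection es x zs ->
     cheaper r (consensus_prog (string_table (catrev zs ys) m)).1) /\
  (forall c, r = Some c -> exists x zs, selection es x zs /\
     (consensus_prog (string_table (catrev zs ys) m)).1 = Some c).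
Proof.
rewrite {}/r; elim: es ys => [|e es IHes] ys esm ysm.
  rewrite [search _ _]/= step_val; split=> [x zs /selection_nil[_ ->]|c cE].
    have [w wE _] := consensus_string_table a0 ysm.
    by rewrite /= wE; do 2!eexists.
  by exists [::], [::].
have branch b y : selected e b = Some y ->
    let r := (bind (add_string y (string_table ys m)) (search es)).1 in
    (forall x zs, selection es x zs ->
       cheaper r (consensus_prog (string_table (catrev (y :: zs) ys) m)).1) /\
    (forall c, r = Some c -> exists x zs, selection es x zs /\
       (consensus_prog (string_table (catrev (y :: zs) ys) m)).1 = Some c).
  move=> eb; have ym : size y = m by apply: esm eb; left.
  rewrite bind_val (add_string_table _ ym); apply: IHes.
    by move=> e' b' z ein; apply: esm; right.
  by move=> z; rewrite inE => /predU1P[->|/ysm].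
(* Naming the subtrees by the projections of [e] lets [branch] apply to both; the right extension
   comes first. *)
have -> : (search (e :: es) (string_table ys m)).1 =
    cheapest (if e.2 is Some y
              then (bind (add_string y (string_table ys m)) (search es)).1
              else None)
             (if e.1 is Some y
              then (bind (add_string y (string_table ys m)) (search es)).1
              else None).
  by case: e {esm branch} => [yl yr]; rewrite /= !timedE /=; case: yl; case: yr.
split=> [x zs /selection_cons[b [x' [z [zs' [_ -> eb sel]]]]]|c].
  have [le_r _] := branch b z eb; have {le_r} := le_r x' zs' sel.
  case: b eb => /= [-> | ->]; [exact: cheapest_r | exact: cheapest_l].
set r2 := (X in cheapest X _); set r1 := (X in cheapest _ X) => cE.
suff [b [y [eb rE]]] : exists b y, selected e b = Some y /\
    (bind (add_string y (string_table ys m)) (search es)).1 = Some c.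
  have [_ /(_ c rE)[x [zs [sel zsE]]]] := branch b y eb.
  by exists (b :: x), (y :: zs); split=> //; apply/selection_cons; exists b, x, y, zs.
have [] := cheapest_mem r2 r1; rewrite cE.
  by rewrite /r2; case e2: e.2 => [y|] // rE; exists false, y; rewrite /selected e2.
by rewrite /r1; case e1: e.1 => [y|] // rE; exists true, y; rewrite /selected e1.
Qed.

End Search.

(** * The program as an instance of [EXTEND] *)

Section Correctness.

Variables (Sigma : finType) (t n l : nat) (S : t.-tuple (n.-tuple Sigma)).
Variable v : l.-tuple Sigma.

(** Transfers [consensus_string_table] to families over ['I_t]; the reversal caused by the
    accumulator changes neither counts nor sums. *)
Lemma consensus_family m (Y : 'I_t -> seq Sigma) (a0 : Sigma) :
  (forall i, size (Y i) = m) ->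
  exists2 w : m.-tuple Sigma, is_consensus Y w &
    (consensus_prog (string_table (rev [seq Y i | i <- enum 'I_t]) m)).1
      = Some (set_cost Y w, tval w).
Proof.
move=> Ym; have [|w wE wmax] :=
  @consensus_string_table _ (rev [seq Y i | i <- enum 'I_t]) m a0.
  by move=> y; rewrite mem_rev => /mapP[i _ ->].
have countE (P : pred (seq Sigma)) :
    count P (rev [seq Y i | i <- enum 'I_t]) = #|[set i | P (Y i)]|.
  by rewrite count_rev count_map -sum1_count -sum1dep_card big_enum_cond.
exists w => [j a|]; first by have := wmax j a; rewrite !countE.
rewrite wE; congr (Some (_, _)); rewrite /set_cost.
rewrite (perm_big [seq Y i | i <- enum 'I_t]); last by rewrite perm_rev.
by rewrite big_map big_enum.
Qed.

Section Occurrences.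

Variable p : 'I_t -> nat.

Let es := [seq extensions_at l (tnth S i) (p i) | i <- enum 'I_t].

Lemma selection_extension (x : t.-tuple bool) zs :
  selection es x zs <->
  extensible n l p x /\ zs = [seq extension S l p x i | i <- enum 'I_t].
Proof.
have selE : [seq selected eb.1 eb.2 | eb <- zip es x] =
    [seq selected (extensions_at l (tnth S i) (p i)) (tnth x i) | i <- enum 'I_t].
  by rewrite -[tval x]map_tnth_enum /es zip_map -map_comp.
have sizeE : size x = size es by rewrite size_map size_enum_ord size_tuple.
have selS i : (if tnth x i then 0 < p i else p i + l < n) ->
    selected (extensions_at l (tnth S i) (p i)) (tnth x i)
      = Some (extension S l p x i).
  by rewrite /selected /extension /extensions_at size_tuple; case: (tnth x i) => /= ->.
split=> [[_]|[xp ->]]; last first.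
  by split=> //; rewrite selE -map_comp; apply: eq_map => i; apply: selS.
rewrite selE => sE; have xp : extensible n l p x.
  (* A missing extension would put [None] into the list of selected extensions, which equals
     [map Some zs]. *)
  move=> i; have : None \notin map Some zs by apply/mapP => -[].
  rewrite -sE; apply: contraR => xi; apply/mapP; exists i; rewrite ?mem_enum //.
  rewrite /selected /extensions_at size_tuple.
  by case: (tnth x i) xi => /= /negPf->.
split=> //; apply: (inj_map (@Some_inj _)); rewrite -sE -[RHS]map_comp.
by apply: eq_map => i; apply: selS.
Qed.

(** [x0] guarantees that some leaf is reached; by [selection_extension] the leaves are exactly the
    extensible [x], so the cheapest leaf is a choice allowed by [EXTEND]. *)
Lemma search_EXTEND x0 (a0 : Sigma) :
  closest_occurrences S v p -> extensible n l p x0 ->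
  exists d (vsol : l.+1.-tuple Sigma), EXTEND S v p vsol /\
    (search es (string_table [::] l.+1)).1 = Some (d, tval vsol).
Proof.
move=> closest_p xp0; have pl i : p i + l <= n by have [] := closest_p i.
have szx x i : extensible n l p x -> size (extension S l p x i) = l.+1.
  exact: size_extension.
have [|//|search_min search_some] := @search_correct _ l.+1 a0 es [::].
  move=> e b y; rewrite /es => /List.in_map_iff[i [<- _]].
  rewrite /selected /extensions_at size_tuple; have := pl i.
  by case: b => /=; case: ifP => // pi {}pl [<-]; rewrite size_window ?size_tuple; lia.
have /search_min : selection es x0 [seq extension S l p x0 i | i <- enum 'I_t].
  exact/selection_extension.
case=> [[d w] [_ [rE _ _]]]; have [x [zs [sel zsE]]] := search_some _ rE.
have szX : size x == t by case: sel => ->; rewrite size_map size_enum_ord.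
have [xp zsx] : _ /\ _ := iffLR (selection_extension (Tuple szX) zs) sel.
have [vsol cons_vsol vsolE] := consensus_family a0 (fun i => szx _ i xp).
move: zsE; rewrite zsx vsolE => -[dE wE].
exists d, vsol; split; last by rewrite rE -wE.
split=> //; exists (Tuple szX); split=> // x' w' xp' cw'.
(* [EXTEND] compares with every consensus [w'], the search with a single one per [x']: that one is
   [w''], and it costs no more than [w']. *)
have [w'' cw'' w''E] := consensus_family a0 (fun i => szx _ i xp').
have /search_min : selection es x' [seq extension S l p x' i | i <- enum 'I_t].
  exact/selection_extension.
case=> [c [c' []]]; rewrite rE [consensus_prog _]/= w''E => -[<-] [<-] /= le_d.
by rewrite dE (leq_trans le_d) // consensus_set_cost_le // => i; apply: szx.
Qed.

End Occurrences.

Lemma scan_allE last (S' : seq (seq Sigma)) :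
  (scan_all last l v S').1 =
  [seq if (scan last l v None s None).1 is Some (_, e) then e else (None, None)
     | s <- S'].
Proof. by elim: S' => //= s S' IHS; rewrite !timedE /= IHS. Qed.

Lemma scan_all_correct last : l <= n ->
  exists2 p : 'I_t -> nat,
    forall i, best_before last l v (tnth S i) n.+1 (p i) &
    (scan_all last l v [seq tval s | s <- S]).1
      = [seq extensions_at l (tnth S i) (p i) | i <- enum 'I_t].
Proof.
move=> ln; have scan_i i : exists q,
    best_before last l v (tnth S i) n.+1 q /\
    (scan last l v None (tnth S i) None).1
      = Some (hamming v (window l q (tnth S i)), extensions_at l (tnth S i) q).
  have [|q] := @scan_correct _ last l v (tnth S i); first by rewrite size_tuple.
  by rewrite size_tuple; exists q.
have [p pP] := fin_all_exists scan_i.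
exists p => [i|]; first by case: (pP i).
rewrite scan_allE -{1}(map_tnth_enum S) -!map_comp; apply: eq_map => i /=.
by have [_ ->] := pP i.
Qed.

Lemma best_before_closest last p :
  (forall i, best_before last l v (tnth S i) n.+1 (p i)) ->
  closest_occurrences S v p.
Proof.
move=> pP i; have [_] := pP i; rewrite size_tuple => pl min_p; split=> // q ql.
by have [] := min_p q _ ql; lia.
Qed.

(** Two closest occurrences in the same string are equally distant from [v], so the tie-break
    decides between their positions. *)
Lemma best_before_extreme last p p' :
  (forall i, best_before last l v (tnth S i) n.+1 (p i)) ->
  closest_occurrences S v p' ->
  forall i, if last then p' i <= p i else p i <= p' i.
Proof.
move=> pP cp' i; have [_] := pP i; rewrite size_tuple => pl min_p.
have [p'l /(_ _ pl) le'] := cp' i; have [|le] := min_p (p' i) _ p'l; first lia.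
by apply; apply/eqP; rewrite eqn_leq le le'.
Qed.

Lemma all_rightE (es : seq (extensions Sigma)) :
  (all_right es).1 = all (fun e => isSome e.2) es.
Proof. by elim: es => [|[yl [yr|]] es IHes] //=; rewrite step_val. Qed.

Lemma extend_prog_correct
    (run := extend_prog (enum Sigma) [seq tval s | s <- S] l v) :
  0 < t -> l < n ->
  (exists p, closest_occurrences S v p /\ extensible_on_one_side n l p) ->
  exists (p : 'I_t -> nat) (vsol : l.+1.-tuple Sigma),
    [/\ run.1 = Some (tval vsol), EXTEND S v p vsol
      & extensible_on_one_side n l p].
Proof.
move=> t0 ln [p0 [cp0 one0]]; rewrite {}/run.
have a0 : Sigma by exact: tnth (tnth S (Ordinal t0)) (Ordinal ln).
have [pl plP plE] := scan_all_correct false (ltnW ln).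
have [pr prP prE] := scan_all_correct true (ltnW ln).
have tnth_const b i : tnth [tuple of nseq t b] i = b.
  by rewrite (tnth_nth b) nth_nseq ltn_ord.
suff [p [one pP esE]] : exists p, [/\ extensible_on_one_side n l p,
    closest_occurrences S v p &
    (if (all_right (scan_all false l v [seq tval s | s <- S]).1).1
     then ret (scan_all false l v [seq tval s | s <- S]).1
     else scan_all true l v [seq tval s | s <- S]).1
    = [seq extensions_at l (tnth S i) (p i) | i <- enum 'I_t]].
  have [x xp] : exists x, extensible n l p x by case: one => xp; eexists; exact: xp.
  have [d [vsol [ext searchE]]] := search_EXTEND a0 pP xp.
  (* Only the list underlying [vsol] is kept, because the type of [vsol] would prevent abstracting
     [l.+1]. *)
  exists p, vsol; split=> //; move: (tval vsol) searchE => w searchE.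
  rewrite /extend_prog; move lm: l.+1 => m.
  by rewrite !timedE esE blank_string_table -lm searchE.
case: ifP; rewrite plE all_rightE all_map.
  move=> /allP right; exists pl; split=> //; last exact: best_before_closest plP.
  left=> i; rewrite tnth_const; have /= := right i (mem_enum _ _).
  by rewrite size_tuple; case: ifP.
(* If [p0] were extensible to the right, so would be the leftmost occurrences, which start no later.
   Hence [p0] is extensible to the left, and so are the rightmost occurrences, which start no
   earlier. *)
move=> /negbT not_right; exists pr; split=> //; last exact: best_before_closest prP.
right=> i; rewrite tnth_const; have pi0 := best_before_extreme prP cp0 i.
case: one0 => [right0|/(_ i)]; last first.
  by rewrite tnth_const => p00; apply: leq_trans p00 pi0.
case/negP: not_right; apply/allP => j _ /=; rewrite size_tuple.
have := right0 j; rewrite tnth_const => lt0.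
by have /= le0 := best_before_extreme plP cp0 j; case: ifP => //; lia.
Qed.

End Correctness.

Theorem theorem3p1 :
  exists c k : nat,
  forall (Sigma : finType) (t n l : nat) (S : t.-tuple (n.-tuple Sigma))
    (vopt : l.-tuple Sigma),
  0 < t -> l < n ->
  optimal_closest_substring S vopt ->
  let run := extend_prog (enum Sigma) [seq tval s | s <- S] l vopt in
  [/\ forall (p : 'I_t -> nat) (vsol : l.+1.-tuple Sigma),
        EXTEND S vopt p vsol -> extensible_on_one_side n l p ->
        forall vopt' : l.+1.-tuple Sigma,
        optimal_closest_substring S vopt' ->
        cost S vsol <= cost S vopt' + t,
      (exists p : 'I_t -> nat,
         closest_occurrences S vopt p /\ extensible_on_one_side n l p) ->
      exists (p : 'I_t -> nat) (vsol : l.+1.-tuple Sigma),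
        [/\ run.1 = Some (tval vsol),
            EXTEND S vopt p vsol &
            extensible_on_one_side n l p] &
      run.2 <= c * (n + #|Sigma|) ^ k * 2 ^ t].
Proof.
exists 100, 2 => Sigma t n l S vopt t0 ln opt /=; split.
- by move=> p vsol ext one vopt' _; apply: EXTEND_approximation opt ext one.
- exact: extend_prog_correct.
have := @extend_prog_time _ (enum Sigma) [seq tval s | s <- S] l n vopt.
rewrite -cardE size_map !size_tuple; apply=> // s /mapP[s' _ ->].
by rewrite size_tuple.
Qed.
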